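(* Let $k\ge1$ and consider the online ranking game with top-1 feedback where an oblivious adversary chooses $r_1,\dots,r_T\in\{0,1\}^m$. Let the learner run algorithm RTop-1F (described in the context) with $K=m^{-1/3}T^{2/3}$ and $\epsilon=\sqrt{1/(mK)}$. Then $$\mathbb{E}\Big[\sum_{t=1}^T Prec@k(\sigma_t,r_t)\Big]\ge\max_\sigma\sum_{t=1}^T Prec@k(\sigma,r_t)-O(km^{2/3}T^{2/3}),$$ the expectation being over the learner's random actions.
   Context: Objects are $\{1,\dots,m\}$; a ranking is a permutation $\sigma$ of $[m]$ with $\sigma(i)$ the rank of object $i$ and $\sigma^{-1}(j)$ the object at rank $j$. $Prec@k(\sigma,r)=\sum_{i=1}^m\mathbb{1}(\sigma(i)\le k)\,r(i)$ (a gain). Game: the oblivious adversary fixes $r_1,\dots,r_T$ in advance; at round $t$ the learner outputs $\sigma_t$ and observes only $r_t(\sigma_t^{-1}(1))$. Algorithm RTop-1F with parameters $K,\epsilon$: split $\{1,\dots,T\}$ into $K$ consecutive blocks $B_i=\{(i-1)T/K+1,\dots,iT/K\}$. Initialize $\hat s_0=\hat r_0=0\in\mathbb{R}^m$. For $i=1,\dots,K$: set $\hat s_i=\hat s_{i-1}+\hat r_{i-1}$; choose $m$ distinct time points $i_1,\dots,i_m$ from $B_i$ uniformly at random without replacement; for each $t\in B_i$: if $t=i_j$, output any permutation placing object $j$ at rank 1 and receive $r_{i_j}(j)$; otherwise sample $p_t$ uniformly from $[0,1/\epsilon]^m$ and output $\sigma_t=\arg\min_\sigma\sigma\cdot(\hat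 s_i+p_t)$ (here $\sigma$ is identified with $(\sigma(1),\dots,\sigma(m))$). At the end of the block set $\hat r_i=(r_{i_1}(1),\dots,r_{i_m}(m))$. *)

(* Defs.v *)
From HB Require Import structures.
From mathcomp Require Import all_boot all_order all_algebra all_fingroup.
From mathcomp Require Import all_classical all_reals all_analysis.
Set Implicit Arguments. Unset Strict Implicit. Unset Printing Implicit Defensive.
Import Order.TTheory GRing.Theory Num.Theory.
Local Open Scope ring_scope.

Section RTop1F.
Variable R : realType.

(* Objects are 'I_m (0-based); a ranking is s : 'S_m with s i the (0-based)
   rank of object i; rank 1 of the paper is rank 0 here.
   Prec@k(s, r) = sum_i 1(rank_paper(i) <= k) r(i) = sum_i 1(s i < k) r(i). *)
Definition prec (m k : nat) (s : 'S_m) (rt : 'I_m -> bool) : R :=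
  \sum_(i : 'I_m) ((s i < k)%N && rt i)%:R.

(* s . v with s identified with the vector of paper ranks (s(1),...,s(m)). *)
Definition dotp (m : nat) (s : 'S_m) (v : 'I_m -> R) : R :=
  \sum_(i : 'I_m) ((s i).+1)%:R * v i.

(* argmin_s s . v (ties broken by a fixed rule; ties have probability 0). *)
Definition argmin_perm (m : nat) (v : 'I_m -> R) : 'S_m :=
  [arg min_(s < (1%g : 'S_m)) dotp s v]%O.

(* Rounds are 0-based t = 0..T-1; block i (0-based, i < K) consists of the
   rounds i*L + s with s < L, L = T/K.  A realization of the discrete
   randomness is c : for each block i, an injective map j |-> c i j giving the
   (position in block i of the) time point i_j at which object j is explored. *)
Definition block_choice (m K L : nat) := {ffun 'I_K -> {ffun 'I_m -> 'I_L}}.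

Definition valid_choice (m K L : nat) (c : block_choice m K L) : bool :=
  [forall i, injectiveb (c i)].

Definition shat (m K L : nat) (r : nat -> 'I_m -> bool)
    (c : block_choice m K L) (i : 'I_K) (j : 'I_m) : R :=
  \sum_(i' < K | (i' < i)%N) (r (i' * L + c i' j)%N j)%:R.

(* The permutation output by RTop-1F at round t = i*L + s, given the discrete
   randomness c and the perturbations P (p_t(j) = P (t*m + j)).
   expl t j is the (arbitrary) permutation placing object j at rank 1 that
   is used when t = i_j. *)
Definition learner (m K L : nat) (expl : nat -> 'I_m -> 'S_m)
    (r : nat -> 'I_m -> bool) (c : block_choice m K L) (P : nat -> R)
    (i : 'I_K) (s : 'I_L) : 'S_m :=
  let t := (i * L + s)%N in
  match [pick j | c i j == s] with
  | Some j => expl t j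
  | None => argmin_perm (fun j => shat r c i j + P (t * m + j)%N)
  end.

Definition total_gain (m k K L : nat) (expl : nat -> 'I_m -> 'S_m)
    (r : nat -> 'I_m -> bool) (c : block_choice m K L) (P : nat -> R) : R :=
  \sum_(i < K) \sum_(s < L)
     prec k (learner expl r c P i s) (r (i * L + s)%N).

(* Expectation over independent uniform coordinates P 0, ..., P (n-1) on
   [0, 1/eps]: iterated (normalized) Lebesgue integral. *)
Fixpoint unif_expect (eps : R) (n : nat) (F : (nat -> R) -> R) : R :=
  match n with
  | 0 => F (fun _ => 0)
  | n'.+1 => eps * Rintegral (@lebesgue_measure R) `[0, eps^-1]%classic
      (fun x => unif_expect eps n'
                  (fun g => F (fun l => if l == n' then x else g l)))
  end.

(* E[ sum_{t<T} Prec@k(sigma_t, r_t) ] for RTop-1F with K blocks and eps: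
   uniform over valid c (each block's ordered m-sample without replacement,
   independently), and independent uniform p_t in [0,1/eps]^m for all t. *)
Definition expected_gain (m k T K : nat) (eps : R)
    (expl : nat -> 'I_m -> 'S_m) (r : nat -> 'I_m -> bool) : R :=
  let L := (T %/ K)%N in
  (#|[pred c : block_choice m K L | valid_choice c]|%:R)^-1 *
  \sum_(c : block_choice m K L | valid_choice c)
     unif_expect eps (T * m) (total_gain k expl r c).

End RTop1F.

(* Main.v *)
Require Import Defs.
From HB Require Import structures.
From mathcomp Require Import all_boot all_order all_algebra all_fingroup.
From mathcomp Require Import all_classical all_reals all_analysis.
From mathcomp Require Import measurable_realfun.
From mathcomp Require Import ring lra zify.
Set Implicit Arguments. Unset Strict Implicit. Unset Printing Implicit Defensive.
Import Order.TTheory GRing.Theory Num.Theory.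
Local Open Scope ring_scope.

(* Minimizing sigma . v sorts the objects by decreasing v, so it maximizes the
   Prec@k gain, and RTop-1F follows the perturbed leader on the block estimates.
   For a fixed realization of the estimates, comparing with the leader that
   already knows the current block telescopes and costs k/eps for the
   perturbation; translating the uniform law on [0,1/eps]^m by a 0/1 vector
   costs at most eps k m per block.  The estimate of a block is unbiased and
   independent of the past, so a block of length L = T/K multiplies this regret
   by L, and the m exploration rounds cost at most k m per block.  The choice of
   K gives L^2 = m K, i.e. eps = 1/L, and the three terms are each k L^2 =
   k m^(2/3) T^(2/3). *)

(** * Translation of Lebesgue integrals on the line *)

Section Translation.
Variable R : realType.
Notation mu := (@lebesgue_measure R).
Local Open Scope classical_set_scope.

Lemma lebesgue_measure_translation (d : R) (A : set (measurableTypeR R)) :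
  measurable A -> mu A = pushforward mu (fun x : measurableTypeR R => x + d : measurableTypeR R) A.
Proof.
have mphi : measurable_fun [set: measurableTypeR R]
    (fun x : measurableTypeR R => x + d : measurableTypeR R).
  exact: measurable_funD.
pose phi : {mfun (measurableTypeR R) >-> (measurableTypeR R)} :=
  HB.pack (fun x : measurableTypeR R => x + d : measurableTypeR R)
    (isMeasurableFun.Build _ _ _ _ _ mphi).
apply: (lebesgue_measure_unique (mu := pushforward mu phi)) => X [[a b] /= _ <-].
rewrite /pushforward (_ : phi @^-1` _ = `](a - d), (b - d)]).
  by rewrite !lebesgue_measure_itv/= !lte_fin ltrD2r -!EFinB opprB addrA subrK.
by apply/seteqP; split => x /=; rewrite !in_itv/= ltrBlDr lerBrDr.
Qed.

Lemma ge0_integral_translation (d : R) (D : set R) (f : R -> \bar R) :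
  measurable D -> measurable_fun D f -> (forall x, 0 <= f x)%E ->
  (\int[mu]_(y in D) f y)%E =
  (\int[mu]_(x in (fun x : R => (x + d)%R) @^-1` D) f (x + d)%R)%E.
Proof.
move=> mD mf f0.
have mphi : measurable_fun [set: measurableTypeR R]
    (fun x : measurableTypeR R => x + d : measurableTypeR R).
  exact: measurable_funD.
rewrite -[RHS](ge0_integral_pushforward mphi)//.
by apply: eq_measure_integral => A mA _; exact: lebesgue_measure_translation.
Qed.

Lemma integrable_bounded_itv (A B : R) (H : R -> R) :
  measurable_fun setT H -> (forall x, 0 <= H x <= B) ->
  mu.-integrable `[0, A] (EFin \o H).
Proof.
move=> mH bH; apply: measurable_bounded_integrable => //.
- by rewrite [ltLHS]lebesgue_measure_itv/=; case: ifP => _; rewrite -?EFinB ltry.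
- exact: measurable_funTS.
- exists B; split => //; first exact: num_real.
  move=> M BM x _ /=; have /andP[H0 HB] := bH x.
  by rewrite ger0_norm// (le_trans HB)// ltW.
Qed.

(** The translated integral runs over [[d, A + d]], which is covered by [[0, A]] and []A, A + d]];
    the second interval has length [d] and the integrand is at most [B] there. *)
Lemma Rintegral_translation_le (A B d : R) (H : R -> R) :
  0 <= A -> 0 <= d -> measurable_fun setT H -> (forall x, 0 <= H x <= B) ->
  Rintegral mu `[0, A] (fun x => H (x + d)) <= Rintegral mu `[0, A] H + B * d.
Proof.
move=> A0 d0 mH bH.
have H0 x : (0 <= (H x)%:E)%E by rewrite lee_fin; case/andP: (bH x).
have mEH D : measurable_fun D (EFin \o H).
  by apply/measurable_EFinP; exact: measurable_funTS.
have iH : (\int[mu]_(x in `[0%R, A]) (H x)%:E \is a fin_num)%E.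
  by apply: integrable_fin_num => //; exact: integrable_bounded_itv bH.
have le1 : (\int[mu]_(x in `[0%R, A]) (H (x + d)%R)%:E <=
            \int[mu]_(x in `[0%R, A]) (H x)%:E + (B * d)%:E)%E.
  have -> : (\int[mu]_(x in `[0%R, A]) (H (x + d)%R)%:E =
             \int[mu]_(x in `[d, (A + d)%R]) (H x)%:E)%E.
    rewrite (ge0_integral_translation d (f := EFin \o H))//=.
    congr (integral _ _ _); apply/seteqP; split => x /=; rewrite !in_itv/=; lra.
  apply: (@le_trans _ _ (\int[mu]_(x in `[0%R, A] `|` `]A, (A + d)%R]) (H x)%:E)%E).
    apply: ge0_subset_integral => //.
      exact: measurableU.
      exact: mEH.
    move=> x /=; rewrite !in_itv/= => /andP[dx xA].
    by case: (leP x A) => xA'; [left|right]; rewrite ?xA ?andbT //; lra.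
  rewrite ge0_integral_setU//; [|exact: mEH|].
  - apply: leeD2l.
    apply: (@le_trans _ _ (\int[mu]_(x in `]A, (A + d)%R]) (cst B%:E) x)%E).
      apply: ge0_le_integral => //.
      + exact: mEH.
      + by move=> x _; rewrite lee_fin; case/andP: (bH x).
    rewrite integral_cst//= lebesgue_measure_itv/= lte_fin.
    case: ifP => [_|/negbT]; rewrite -?EFinB -?EFinM lee_fin//.
      by rewrite addrAC subrr add0r.
    move=> _; rewrite mulr0 mulr_ge0//.
    by case/andP: (bH 0) => /le_trans h /h.
  - apply/disj_setPS => x [/=]; rewrite !in_itv/= => /andP[_ xA] /andP[]; lra.
rewrite /Rintegral -lee_fin EFinD (fineK iH) (le_trans _ le1)//.
rewrite fineK// ge0_fin_numE; last exact: integral_ge0.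
by rewrite (le_lt_trans le1)// ltey_eq fin_numD iH.
Qed.

End Translation.

(** * Calculus of the iterated uniform expectation *)

Section UniformExpectation.
Variable R : realType.
Notation mu := (@lebesgue_measure R).
Local Open Scope classical_set_scope.

(* Measurability of a function of infinitely many real coordinates, expressed
   by composition with measurable coordinates so that no sigma-algebra on
   [nat -> R] is needed; [h] carries extra parameters. *)
Definition param_measurable d (X : measurableType d) (F : X -> (nat -> R) -> R) :=
  forall d' (Y : measurableType d') (h : Y -> X) (g : nat -> Y -> R),
    measurable_fun setT h -> (forall l, measurable_fun setT (g l)) ->
    measurable_fun setT (fun y => F (h y) (g^~ y)).

Definition coord_measurable (F : (nat -> R) -> R) :=
  forall d (Y : measurableType d) (g : nat -> Y -> R),
    (forall l, measurable_fun setT (g l)) ->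
    measurable_fun setT (fun y => F (g^~ y)).

Definition update (g : nat -> R) n x := fun l => if l == n then x else g l.

Lemma unif_expectS (eps : R) n F : unif_expect eps n.+1 F =
  eps * Rintegral mu `[0, eps^-1]
          (fun x => unif_expect eps n (fun g => F (update g n x))).
Proof. by []. Qed.

Lemma eq_unif_expect (eps : R) n F G : F =1 G -> unif_expect eps n F = unif_expect eps n G.
Proof. by move=> /funext ->. Qed.

Variable eps : R.
Hypothesis eps_gt0 : 0 < eps.

Lemma unif_expect_ge0 n F : (forall P, 0 <= F P) -> 0 <= unif_expect eps n F.
Proof.
elim: n F => [|n IH] F F0 //=.
by rewrite mulr_ge0 ?(ltW eps_gt0)//; apply: Rintegral_ge0 => x _; exact: IH.
Qed.

Lemma measurable_param_integral d (X : measurableType d) (D : set R)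
    (f : X * measurableTypeR R -> R) :
  measurable D -> measurable_fun setT f -> (forall z, 0 <= f z) ->
  measurable_fun setT (fun x => Rintegral mu D (fun z => f (x, z))).
Proof.
move=> mD mf f0; apply: (@measurableT_comp _ _ _ _ _ _ fine) => //.
pose D2 : set (X * measurableTypeR R) := snd @^-1` D.
have mD2 : measurable D2 by rewrite -[D2]setTI; exact: measurable_snd.
have mf2 : measurable_fun setT ((EFin \o f) \_ D2).
  apply/(measurable_restrictT _ mD2); apply/measurable_EFinP.
  exact: measurable_funTS.
have := measurable_fun_fubini_tonelli_F (m2 := mu) _ mf2.
rewrite /fubini_F.
have <- : (fun x => \int[mu]_(z in D) (f (x, z))%:E)%E =
       (fun x => \int[mu]_z ((EFin \o f) \_ D2) (x, z))%E.
  apply/funext => x; rewrite integral_mkcond; apply: eq_integral => z _.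
  by rewrite !patchE /D2; congr (if _ then _ else _); rewrite !inE; apply/idP/idP.
apply => z; rewrite patchE; case: ifP => // _; rewrite lee_fin.
exact: f0.
Qed.

(** The induction lets the parameter space vary: the outermost integration variable joins the
    parameter, giving [X * R], and Tonelli's theorem handles its integration. This is why
    [param_measurable] ranges over an arbitrary [X]. *)
Lemma measurable_unif_expect n d (X : measurableType d) (F : X -> (nat -> R) -> R) :
  param_measurable F -> (forall x P, 0 <= F x P) ->
  measurable_fun setT (fun x => unif_expect eps n (F x)).
Proof.
elim: n d X F => [|n IH] d X F mF F0 /=.
  by apply: (mF _ _ id (fun _ _ => 0)).
apply: measurable_funM => //.
pose f (w : X * measurableTypeR R) := unif_expect eps n (fun g => F w.1 (update g n w.2)).
apply: (@measurable_param_integral _ _ _ f) => //; last first.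
  by move=> z; apply: unif_expect_ge0.
apply: IH => // d' Y h g mh mg.
apply: (mF _ _ (fst \o h) (fun l y => if l == n then (h y).2 else g l y)).
  exact: measurableT_comp.
by move=> l; case: (l == n) => //; exact: (measurableT_comp measurable_snd mh).
Qed.

Lemma coord_measurable_update F n : coord_measurable F ->
  param_measurable (fun (x : measurableTypeR R) g => F (update g n x)).
Proof.
move=> mF d Y h g mh mg.
by apply: (mF _ _ (fun l y => if l == n then h y else g l y)) => l; case: (l == n).
Qed.

Lemma coord_measurable_update1 F n x : coord_measurable F ->
  coord_measurable (fun g => F (update g n x)).
Proof.
move=> mF d Y g mg.
by apply: (mF _ _ (fun l y => if l == n then x else g l y)) => l; case: (l == n).
Qed.

Lemma measurable_unif_expect_update n F : coord_measurable F ->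
  (forall P, 0 <= F P) ->
  measurable_fun setT
    (fun x : R => unif_expect eps n (fun g => F (update g n x))).
Proof.
move=> mF F0; apply: (@measurable_unif_expect n _ (measurableTypeR R)) => //.
exact: coord_measurable_update.
Qed.

Lemma unif_expect_cst n (c : R) : unif_expect eps n (fun _ => c) = c.
Proof.
elim: n => [//|n IH]; rewrite unif_expectS IH Rintegral_cst//.
rewrite [X in fine X]lebesgue_measure_itv/= lte_fin invr_gt0 eps_gt0 /=.
by rewrite subr0 mulrCA divff ?mulr1// gt_eqF.
Qed.

Definition bounded_by (B : R) (F : (nat -> R) -> R) := forall P, 0 <= F P <= B.

Lemma bounded_by_ge0 B F : bounded_by B F -> forall P, 0 <= F P.
Proof. by move=> bF P; case/andP: (bF P). Qed.

Hint Resolve bounded_by_ge0 : core.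

Lemma unif_expect_le n F (B : R) : coord_measurable F -> bounded_by B F ->
  0 <= unif_expect eps n F <= B.
Proof.
elim: n F => [|n IH] F mF bF; first exact: bF.
rewrite unif_expect_ge0 ?unif_expectS; [|by eauto].
rewrite -[leRHS](unif_expect_cst n.+1 B) unif_expectS ler_pM2l//.
have IHx x := IH _ (coord_measurable_update1 n x mF) (fun P => bF (update P n x)).
apply: le_Rintegral => //.
- apply: (@integrable_bounded_itv _ _ B) => //.
  by apply: measurable_unif_expect_update => //; eauto.
- apply: (@integrable_bounded_itv _ _ B) => // x.
  rewrite unif_expect_cst lexx andbT.
  by case/andP: (bF (fun=> 0)) => /le_trans h /h.
- move=> x _; rewrite unif_expect_cst.
  by case/andP: (IHx x).
Qed.

Lemma integrable_unif_expect n F (B : R) : coord_measurable F -> bounded_by B F ->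
  mu.-integrable `[0, eps^-1]
    (EFin \o (fun x => unif_expect eps n (fun g => F (update g n x)))).
Proof.
move=> mF bF; apply: (@integrable_bounded_itv _ _ B).
  by apply: measurable_unif_expect_update => //; eauto.
move=> x; apply: unif_expect_le; first exact: coord_measurable_update1.
by move=> P; exact: bF.
Qed.

Lemma unif_expect_mono n F G (B C : R) :
  coord_measurable F -> bounded_by B F -> coord_measurable G -> bounded_by C G ->
  (forall P, (forall l, 0 <= P l <= eps^-1) -> F P <= G P) ->
  unif_expect eps n F <= unif_expect eps n G.
Proof.
elim: n F G => [|n IH] F G mF bF mG bG FG.
  (* The base case evaluates at the zero sequence, which lies in the cube. *)
  by apply: FG => _; rewrite lexx invr_ge0 ltW.
rewrite !unif_expectS ler_pM2l//.
apply: le_Rintegral => //.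
- exact: integrable_unif_expect bF.
- exact: integrable_unif_expect bG.
- move=> x; rewrite /= in_itv /= => xe; apply: IH.
  + exact: coord_measurable_update1.
  + by move=> P; exact: bF.
  + exact: coord_measurable_update1.
  + by move=> P; exact: bG.
  + by move=> P Pe; apply: FG => l; rewrite /update; case: (l == n).
Qed.

Lemma unif_expectD n F G (B C : R) :
  coord_measurable F -> bounded_by B F -> coord_measurable G -> bounded_by C G ->
  unif_expect eps n (fun P => F P + G P) = unif_expect eps n F + unif_expect eps n G.
Proof.
elim: n F G => [//|n IH] F G mF bF mG bG.
rewrite !unif_expectS -mulrDr -RintegralD//; last 2 first.
- exact: integrable_unif_expect bF.
- exact: integrable_unif_expect bG.
congr (_ * Rintegral _ _ _); apply/funext => x; apply: IH.
- exact: coord_measurable_update1.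
- by move=> P; exact: bF.
- exact: coord_measurable_update1.
- by move=> P; exact: bG.
Qed.

Lemma coord_measurable_cst (c : R) : coord_measurable (fun _ => c).
Proof. by []. Qed.

Lemma coord_measurableD F G : coord_measurable F -> coord_measurable G ->
  coord_measurable (fun P => F P + G P).
Proof. by move=> mF mG d Y g mg; apply: measurable_funD; [exact: mF|exact: mG]. Qed.

Lemma coord_measurable_sum (I : Type) (s : seq I) (F : I -> (nat -> R) -> R) :
  (forall i, coord_measurable (F i)) ->
  coord_measurable (fun P => \sum_(i <- s) F i P).
Proof. by move=> mF d Y g mg; apply: measurable_sum => i; exact: mF. Qed.

Lemma bounded_by_sum (I : Type) (s : seq I) (F : I -> (nat -> R) -> R) (B : I -> R) :
  (forall i, bounded_by (B i) (F i)) ->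
  bounded_by (\sum_(i <- s) B i) (fun P => \sum_(i <- s) F i P).
Proof.
move=> bF P; rewrite sumr_ge0 ?ler_sum// => i _; by case/andP: (bF i P).
Qed.

Lemma unif_expect_sum n (I : Type) (s : seq I) (F : I -> (nat -> R) -> R) (B : I -> R) :
  (forall i, coord_measurable (F i)) -> (forall i, bounded_by (B i) (F i)) ->
  unif_expect eps n (fun P => \sum_(i <- s) F i P) =
  \sum_(i <- s) unif_expect eps n (F i).
Proof.
move=> mF bF; elim: s => [|i s IH].
  by under eq_unif_expect do rewrite big_nil; rewrite unif_expect_cst big_nil.
under eq_unif_expect do rewrite big_cons.
rewrite big_cons -IH (@unif_expectD _ _ _ (B i) (\sum_(i <- s) B i))//.
  exact: coord_measurable_sum.
exact: bounded_by_sum.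
Qed.

Definition depends_below n (F : (nat -> R) -> R) :=
  forall P Q, (forall l, (l < n)%N -> P l = Q l) -> F P = F Q.

Lemma depends_below_update n F x : depends_below n.+1 F ->
  depends_below n (fun g => F (update g n x)).
Proof.
move=> dF P Q PQ; apply: dF => l; rewrite /update ltnS leq_eqVlt.
by case: eqP => //= _; exact: PQ.
Qed.

Lemma unif_expect_extra n k F : depends_below n F ->
  unif_expect eps (n + k) F = unif_expect eps n F.
Proof.
move=> dF; elim: k => [|k IH]; first by rewrite addn0.
rewrite addnS unif_expectS.
under eq_Rintegral => x _.
  rewrite (_ : (fun g => F (update g (n + k)%N x)) = F); last first.
    apply/funext => g; apply: dF => l ln; rewrite /update.
    by case: eqP => // e; move: ln; rewrite e; lia.
  over.
have := unif_expect_cst k.+1 (unif_expect eps (n + k) F).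
rewrite unif_expectS.
by under eq_Rintegral => x _ do rewrite unif_expect_cst; rewrite -IH.
Qed.

(** Together with [unif_expect_extra], this treats the perturbation of one round as a vector on its
    own, whatever window of coordinates it occupies. *)
Lemma unif_expect_shift a n F : depends_below n F ->
  unif_expect eps (a + n) (fun P => F (fun l => P (a + l)%N)) = unif_expect eps n F.
Proof.
elim: n F => [|n IH] F dF.
  rewrite addn0 -[RHS](unif_expect_cst a); apply: eq_unif_expect => P /=.
  exact: dF.
rewrite addnS !unif_expectS; congr (_ * Rintegral _ _ _); apply/funext => x.
rewrite -(IH _ (depends_below_update x dF)); apply: eq_unif_expect => P.
by congr F; apply/funext => l; rewrite /update eqn_add2l.
Qed.

(* In each coordinate the translate of the uniform law on [0, 1/eps] by [d]
   exceeds that law only on an interval of mass [eps * d]. *)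
Lemma unif_expect_translation n F (B : R) (d : nat -> R) :
  depends_below n F -> coord_measurable F -> bounded_by B F ->
  (forall l, 0 <= d l) ->
  unif_expect eps n (fun P => F (fun l => P l + d l)) <=
  unif_expect eps n F + eps * B * \sum_(l < n) d l.
Proof.
move=> + + + d0; elim: n F => [|n IH] F dF mF bF /=.
  by rewrite big_ord0 mulr0 addr0 (dF _ (fun=> 0)).
have B0 : 0 <= B by case/andP: (bF (fun=> 0)) => /le_trans h /h.
pose H y := unif_expect eps n (fun g => F (update g n y)).
pose c := eps * B * \sum_(l < n) d l.
have c0 : 0 <= c by rewrite !mulr_ge0 ?(ltW eps_gt0)// sumr_ge0.
have mH : measurable_fun setT H.
  by apply: measurable_unif_expect_update => //; eauto.
have bH x : 0 <= H x <= B.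
  apply: unif_expect_le; first exact: coord_measurable_update1.
  by move=> P; exact: bF.
have mHd : measurable_fun setT (fun x : R => H (x + d n)).
  apply: (measurableT_comp mH); exact: measurable_funD.
have iH : mu.-integrable `[0, eps^-1] (EFin \o (fun x => H (x + d n))).
  exact: integrable_bounded_itv (fun x => bH (x + d n)).
have ic : mu.-integrable `[0, eps^-1] (EFin \o (fun _ => c)).
  by apply: (@integrable_bounded_itv _ _ c) => // x; rewrite c0 lexx.
have updE x g : (fun l => update g n x l + d l) = update (fun l => g l + d l) n (x + d n).
  by apply/funext => l; rewrite /update; case: eqP => // ->.
have mFd : coord_measurable (fun P => F (fun l => P l + d l)).
  by move=> d' Y g mg; apply: (mF _ _ (fun l y => g l y + d l)) => l; exact: measurable_funD.
(* With coordinate [n] fixed, the induction hypothesis pays [c] for the coordinates below it;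
   translating coordinate [n] then costs [eps * B * d n]. *)
apply: (@le_trans _ _ (eps * Rintegral mu `[0, eps^-1] (fun x => H (x + d n) + c))).
  rewrite ler_pM2l//; apply: le_Rintegral => //.
  - exact: (@integrable_unif_expect n _ B mFd (fun P => bF _)).
  - apply: (@integrable_bounded_itv _ _ (B + c)); first exact: measurable_funD.
    by move=> x; have /andP[? ?] := bH (x + d n); rewrite addr_ge0//= lerD2r.
  - move=> x _ /=.
    under eq_unif_expect do rewrite updE.
    apply: IH.
    + exact: depends_below_update.
    + exact: coord_measurable_update1.
    + by move=> P; exact: bF.
rewrite RintegralD//.
have cE : eps * Rintegral mu `[0, eps^-1] (fun=> c) = c.
  by have := unif_expect_cst 1 c.
rewrite mulrDr cE big_ord_recr/= mulrDr -/c [leRHS]addrA [X in _ <= X]addrAC lerD2r.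
rewrite -[eps * B * d n]mulrA -mulrDr ler_pM2l//.
by apply: Rintegral_translation_le => //; rewrite invr_ge0 ltW.
Qed.

End UniformExpectation.

(** * Top-k sums and their maximization by sorting *)

Section TopK.
Variables (R : realType) (m k : nat).
Implicit Types (s t : 'S_m) (v : 'I_m -> R).

Definition topk_sum s v : R := \sum_i (s i < k)%N%:R * v i.

Lemma precE s (rt : 'I_m -> bool) :
  prec R k s rt = topk_sum s (fun j => (rt j)%:R).
Proof. by apply: eq_bigr => i _; rewrite -natrM mulnb. Qed.

Lemma topk_sumD s v w :
  topk_sum s (fun j => v j + w j) = topk_sum s v + topk_sum s w.
Proof. by rewrite -big_split; apply: eq_bigr => i _; rewrite mulrDr. Qed.

Lemma topk_sum_sum (I : Type) (l : seq I) (P : pred I) s (v : I -> 'I_m -> R) :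
  topk_sum s (fun j => \sum_(i <- l | P i) v i j) =
  \sum_(i <- l | P i) topk_sum s (v i).
Proof.
by rewrite /topk_sum exchange_big; apply: eq_bigr => i _; rewrite mulr_sumr.
Qed.

(** Reindexed by the inverse permutation, each side counts the ranks below [k]. *)
Lemma topk_card s t : \sum_i (s i < k)%N%:R = \sum_i (t i < k)%N%:R :> R.
Proof.
rewrite (reindex_inj (@perm_inj _ (s^-1)%g)) [RHS](reindex_inj (@perm_inj _ (t^-1)%g)).
by apply: eq_bigr => i _; rewrite !permKV.
Qed.

Lemma topk_card_le s : \sum_i (s i < k)%N%:R <= k%:R :> R.
Proof.
rewrite (reindex_inj (@perm_inj _ (s^-1)%g)).
under eq_bigr do rewrite permKV.
rewrite -natr_sum ler_nat.
have -> : (\sum_(i < m) (i < k) = \sum_(0 <= i < m) (i < k))%N by rewrite big_mkord.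
elim: m => [|n IH]; first by rewrite big_geq.
rewrite big_nat_recr//=; case: (ltnP n k) => [nk|_]; last by rewrite addn0.
rewrite addn1 (leq_ltn_trans _ nk)//.
rewrite (leq_trans (n := \sum_(0 <= i < n) 1))//.
  by apply: leq_sum => i _; case: (i < k)%N.
by rewrite sum_nat_const_nat muln1 subn0.
Qed.

Lemma prec_ge0 s (rt : 'I_m -> bool) : 0 <= prec R k s rt.
Proof. exact: sumr_ge0. Qed.

Lemma topk_sum_le s v (B : R) : 0 <= B -> (forall j, v j <= B) ->
  topk_sum s v <= k%:R * B.
Proof.
move=> B0 vB; rewrite (le_trans (y := \sum_i (s i < k)%N%:R * B))//.
  by apply: ler_sum => i _; rewrite ler_wpM2l.
by rewrite -mulr_suml ler_wpM2r ?topk_card_le.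
Qed.

Lemma prec_le s (rt : 'I_m -> bool) : prec R k s rt <= k%:R.
Proof.
rewrite precE -[leRHS]mulr1; apply: topk_sum_le => // j.
by case: (rt j).
Qed.

Lemma ler_topk_sum s v w : (forall j, v j <= w j) -> topk_sum s v <= topk_sum s w.
Proof. by move=> vw; apply: ler_sum => i _; rewrite ler_wpM2l. Qed.

Lemma argmin_permP v t : dotp (argmin_perm v) v <= dotp t v.
Proof. by rewrite /argmin_perm; case: arg_minP => // s _ /(_ t isT). Qed.

(* Otherwise exchanging the ranks of i and j would lower the dot product. *)
Lemma argmin_perm_sorted v i j :
  (argmin_perm v i < argmin_perm v j)%N -> v j <= v i.
Proof.
set s := argmin_perm v => sij.
have ij : i != j by apply: contraTneq sij => ->; rewrite ltnn.
have := argmin_permP v (tperm i j * s)%g.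
rewrite /dotp -/s (bigD1 i)// (bigD1 j) 1?eq_sym//=.
rewrite [leRHS](bigD1 i)// [in leRHS](bigD1 j) 1?eq_sym//=.
rewrite !permM tpermL tpermR.
have -> : \sum_(l | (l != i) && (l != j)) ((tperm i j * s)%g l).+1%:R * v l =
    \sum_(l | (l != i) && (l != j)) (s l).+1%:R * v l.
  apply: eq_bigr => l /andP[li lj].
  by rewrite permM tpermD// eq_sym.
rewrite !addrA lerD2r => h.
have {}sij : (s i).+1%:R < (s j).+1%:R :> R by rewrite ltr_nat ltnS.
by rewrite -subr_ge0 -(pmulr_rge0 _ (_ : 0 < (s j).+1%:R - (s i).+1%:R)) ?subr_gt0//; lra.
Qed.

(** The object [o] just below the top [k] of the minimizer gives a threshold [v o]: scores are at
    least [v o] inside this top [k] and at most [v o] outside, so any exchange of objects can only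
    lose. *)
Lemma topk_sum_argmin_max v t : topk_sum t v <= topk_sum (argmin_perm v) v.
Proof.
set s := argmin_perm v.
(* When [m <= k] every object is in the top [k] of both rankings, and no threshold object exists. *)
case: (leqP m k) => [mk|km].
  by rewrite le_eqVlt; apply/orP; left; apply/eqP; apply: eq_bigr => i _;
    rewrite !(leq_trans (ltn_ord _) mk).
pose o := (s^-1)%g (Ordinal km).
have so : s o = Ordinal km by rewrite permKV.
rewrite -subr_ge0 -sumrB.
(* The two top-k sets have the same size, so [v o] may be subtracted from every score; each term is
   then nonnegative. *)
have -> : \sum_i ((s i < k)%N%:R * v i - (t i < k)%N%:R * v i) =
    \sum_i ((s i < k)%N%:R - (t i < k)%N%:R) * (v i - v o).
  under [RHS]eq_bigr do rewrite mulrBr mulrBl.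
  by rewrite [RHS]sumrB -mulr_suml [X in _ - X * _]sumrB (topk_card s t) subrr mul0r subr0.
apply: sumr_ge0 => i _; case: (ltnP (s i) k) => sik.
  rewrite mulr_ge0// ?subr_ge0 ?ler1n ?lern1 ?leq_b1//.
  by apply: argmin_perm_sorted; rewrite -/s so.
have : v i <= v o.
  case: (eqVneq i o) => [->//|io].
  apply: argmin_perm_sorted; rewrite -/s so /= ltn_neqAle sik andbT.
  apply: contra_neqN io => /eqP e; apply: (@perm_inj _ s).
  by rewrite so; apply: val_inj.
move=> vio; rewrite sub0r mulNr -mulrN opprB mulr_ge0// subr_ge0.
by [].
Qed.

End TopK.

(** * Measurability of the perturbed argmin *)

Section ArgminMeasurable.
Variables (R : realType) (m : nat).

(** The function is a finite sum, over all boolean tables [t], of [psi t] times the indicator that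
    the observed table is [t]; that indicator is a product of measurable factors. *)
Lemma measurable_fin_factor d (Y : measurableType d) (I : finType)
    (b : Y -> I -> bool) (psi : {ffun I -> bool} -> R) :
  (forall i, measurable_fun setT (b^~ i)) ->
  measurable_fun setT (fun y => psi [ffun i => b y i]).
Proof.
move=> mb.
have -> : (fun y => psi [ffun i => b y i]) =
    (fun y => \sum_(t : {ffun I -> bool})
        (\prod_(i : I) (if t i then (if b y i then 1 else 0)
                        else (if b y i then 0 else 1))) * psi t).
  apply/funext => y; rewrite (bigD1 [ffun i => b y i])//= [X in _ = _ + X]big1 ?addr0.
    rewrite big1 ?mul1r// => i _; rewrite ffunE; by case: (b y i).
  move=> t; rewrite eq_sym => /eqP/ffunP nt.
  have /existsP[i ti] : [exists i, t i != b y i].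
    apply/existsPn => h; apply: nt => i; rewrite ffunE; apply/esym/eqP.
    by have := h i; rewrite negbK.
  rewrite (bigD1 i)//=; suff -> : (if t i then if b y i then 1 else 0
      else if b y i then 0 else 1) = 0 :> R by rewrite !mul0r.
  by move: ti; case: (t i); case: (b y i).
apply: measurable_sum => t; apply: measurable_funM => //.
apply: measurable_prod => i _.
by case: (t i); apply: measurable_fun_ifT.
Qed.

(** The argmin, ties included, depends on the scores only through the finite table of comparisons
    between dot products, and each comparison is a measurable event. *)
Definition argmin_of_order (b : {ffun 'S_m * 'S_m -> bool}) : 'S_m :=
  odflt 1%g [pick s | [forall t, b (s, t)]].

Lemma argmin_permE (v : 'I_m -> R) :
  argmin_perm v = argmin_of_order [ffun p => dotp p.1 v <= dotp p.2 v].
Proof.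
rewrite /argmin_perm /Order.arg_min /extremum /argmin_of_order.
congr odflt; apply: eq_pick => s /=.
by apply: eq_forallb => t; rewrite ffunE.
Qed.

Lemma coord_measurable_argmin (phi : 'S_m -> R) (u : 'I_m -> R) (a : nat) :
  coord_measurable
    (fun P => phi (argmin_perm (fun j : 'I_m => u j + P (a + j)%N))).
Proof.
move=> d Y g mg; under eq_fun do rewrite argmin_permE.
apply: (measurable_fin_factor (phi \o argmin_of_order)
  (b := fun y (p : 'S_m * 'S_m) => dotp p.1 (fun j => u j + g (a + j)%N y)
         <= dotp p.2 (fun j => u j + g (a + j)%N y))) => p.
by apply: measurable_fun_ler; apply: measurable_sum => j;
  apply: measurable_funM => //; apply: measurable_funD.
Qed.
End ArgminMeasurable.

(** * Uniformity of the exploration positions *)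

Section Unbiased.
Variables (R : realType) (m K L : nat).
Implicit Types (c : block_choice m K L) (i : 'I_K) (j : 'I_m) (a b : 'I_L).

Definition swap_positions i a b c : block_choice m K L :=
  [ffun i' => if i' == i then [ffun j => tperm a b (c i' j)] else c i'].

Lemma swap_positionsK i a b : involutive (swap_positions i a b).
Proof.
move=> c; apply/ffunP => i'; rewrite !ffunE; case: eqP => // ->.
by apply/ffunP => j; rewrite !ffunE tpermK.
Qed.

Lemma valid_swap_positions i a b c :
  valid_choice (swap_positions i a b c) = valid_choice c.
Proof.
apply: eq_forallb => i'; rewrite !ffunE; case: eqP => // _.
apply/injectiveP/injectiveP => inj x y.
  by move=> e; apply: inj; rewrite !ffunE e.
by rewrite !ffunE => /perm_inj/inj.
Qed.

(* Exchanging two positions of block [i] preserves validity, hence [c i j] is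
   uniform on the block and independent of the other blocks. *)
Lemma sum_valid_choice_uniform (W : block_choice m K L -> R) i j (f : 'I_L -> R) :
  (forall c c', (forall i', i' != i -> c i' = c' i') -> W c = W c') ->
  L%:R * \sum_(c | valid_choice c) W c * f (c i j) =
  \sum_(c | valid_choice c) W c * \sum_s f s.
Proof.
move=> Wi.
(* [N a] is the weighted mass of the choices exploring [j] at position [a]. All [L] masses are equal
   by symmetry and add up to the total mass. *)
pose N a := \sum_(c | valid_choice c) W c * (c i j == a)%:R.
have NE a b : N a = N b.
  rewrite /N (reindex_inj (inv_inj (swap_positionsK i a b))).
  apply: eq_big => [c|c _]; first exact: valid_swap_positions.
  congr (_ * _).
    by apply: Wi => i' /negPf ii'; rewrite ffunE ii'.
  rewrite !ffunE eqxx ffunE; congr (_%:R).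
  by rewrite -{2}(tpermR a b) (inj_eq perm_inj).
have LN a : L%:R * N a = \sum_(c | valid_choice c) W c.
  transitivity (\sum_(b < L) N b).
    by rewrite (eq_bigr (fun=> N a))// sumr_const card_ord mulr_natl.
  rewrite exchange_big; apply: eq_bigr => c _.
  by rewrite -mulr_sumr (bigD1 (c i j))//= eqxx big1 ?addr0 ?mulr1// => b;
    rewrite eq_sym => /negPf ->.
rewrite -mulr_suml [RHS]mulr_sumr.
transitivity (L%:R * \sum_a N a * f a).
  congr (_ * _).
  under [RHS]eq_bigr do rewrite mulr_suml.
  rewrite exchange_big; apply: eq_bigr => c _.
  rewrite (bigD1 (c i j))//= eqxx mulr1 big1 ?addr0// => b.
  by rewrite eq_sym => /negPf ->; rewrite mulr0 mul0r.
by rewrite mulr_sumr; apply: eq_bigr => a _; rewrite mulrA LN.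
Qed.

(** Makes the normalizing count nonzero: exploring object [j] at position [j] of every block is a
    valid choice. *)
Lemma valid_choice_exists : (m <= L)%N ->
  (0 < #|[pred c : block_choice m K L | valid_choice c]|)%N.
Proof.
move=> mL; apply/card_gt0P; exists [ffun _ => [ffun j => widen_ord mL j]].
rewrite inE; apply/forallP => i; apply/injectiveP => x y.
by rewrite !ffunE => /(congr1 val) /= e; apply: val_inj.
Qed.

Lemma explored_card c i :
  (\sum_(s < L) [exists j, c i j == s] <= m)%N.
Proof.
rewrite (@leq_trans (\sum_(s < L) \sum_(j < m) (c i j == s)))//.
  apply: leq_sum => s _; case: existsP => // -[j cj].
  by rewrite (bigD1 j)//= cj.
rewrite exchange_big (eq_bigr (fun=> 1%N)) ?sum1_card ?card_ord// => j _.
rewrite (bigD1 (c i j))//= eqxx big1 ?addn0// => b.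
by rewrite eq_sym => /negPf ->.
Qed.

End Unbiased.

(** * Regret of the perturbed leader on a fixed reward sequence *)

Section PerturbedLeader.
Variables (R : realType) (m k K : nat) (q : 'I_K -> 'I_m -> bool).

(** The bound [n] is a [nat], so that [cum K] can stand for the total over all blocks. *)
Definition cum (n : nat) (j : 'I_m) : R := \sum_(i < K | (i < n)%N) (q i j)%:R.

Lemma sum_ord_ltS (V : nmodType) (F : 'I_K -> V) (n : 'I_K) :
  \sum_(i < K | (i < n.+1)%N) F i = \sum_(i < K | (i < n)%N) F i + F n.
Proof.
rewrite (bigD1 n)//= addrC; congr (_ + _); apply: eq_bigl => i.
by rewrite ltnS ltn_neqAle andbC.
Qed.

Lemma cumS (i : 'I_K) j : cum i.+1 j = cum i j + (q i j)%:R.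
Proof. exact: sum_ord_ltS. Qed.

Lemma cum_full j : cum K j = \sum_i (q i j)%:R.
Proof. by apply: eq_bigl => i; rewrite ltn_ord. Qed.

Definition leader (u : 'I_m -> R) (p : nat -> R) : 'S_m :=
  argmin_perm (fun j : 'I_m => u j + p j).

(** By induction, the value of the new leader splits into its gain on the new block and its value on
    the old scores, which is at most that of the old leader. At [n = 0] only the perturbation
    remains, worth at most [A] per top place. *)
Lemma be_the_leader (p : nat -> R) (A : R) n : 0 <= A ->
  (forall l, 0 <= p l <= A) -> (n <= K)%N ->
  topk_sum k (leader (cum n) p) (fun j => cum n j + p j) <=
  k%:R * A + \sum_(i < K | (i < n)%N) prec R k (leader (cum i.+1) p) (q i).
Proof.
move=> A0 pA; elim: n => [_|n IH nK].
  rewrite [X in _ + X]big_pred0 // addr0; apply: topk_sum_le => // j.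
  by rewrite /cum big_pred0 // add0r; case/andP: (pA j).
pose i := Ordinal nK.
rewrite (sum_ord_ltS _ i) /= addrA.
apply: (@le_trans _ _ (topk_sum k (leader (cum n) p) (fun j => cum n j + p j) +
    prec R k (leader (cum n.+1) p) (q i))); last by rewrite lerD2r IH// ltnW.
rewrite precE (_ : (fun j => cum n.+1 j + p j) =
    (fun j => (cum n j + p j) + (q i j)%:R)); last first.
  by apply/funext => j; rewrite (cumS i) addrAC.
by rewrite topk_sumD lerD2r topk_sum_argmin_max.
Qed.

Variable eps : R.
Hypothesis eps_gt0 : 0 < eps.

Lemma depends_below_leader (phi : 'S_m -> R) u :
  depends_below m (fun p => phi (leader u p)).
Proof. by move=> P Q PQ; congr phi; congr argmin_perm; apply/funext => j; rewrite PQ. Qed.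

Lemma coord_measurable_leader (phi : 'S_m -> R) u :
  coord_measurable (fun p => phi (leader u p)).
Proof. exact: (coord_measurable_argmin phi u 0). Qed.

Lemma prec_bounded_by (s : (nat -> R) -> 'S_m) rt :
  bounded_by k%:R (fun p => prec R k (s p) rt).
Proof. by move=> p; rewrite prec_ge0 prec_le. Qed.

(** Adding [rt] to the scores amounts to translating the perturbation by a 0/1 vector, and the gain
    is bounded by [k]. *)
Lemma leader_stability u (rt : 'I_m -> bool) :
  unif_expect eps m
    (fun p => prec R k (leader (fun j => u j + (rt j)%:R) p) rt) <=
  unif_expect eps m (fun p => prec R k (leader u p) rt) + eps * k%:R * m%:R.
Proof.
(* [rt] extended by 0 to all indices, since perturbations are sequences over [nat]. *)
pose d (l : nat) : R := if insub l is Some j then (rt j)%:R else 0.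
have d0 l : 0 <= d l by rewrite /d; case: insub.
have d1 l : d l <= 1 by rewrite /d; case: insub => // j; case: (rt j).
have -> : (fun p => prec R k (leader (fun j => u j + (rt j)%:R) p) rt) =
    (fun p => prec R k (leader u (fun l => p l + d l)) rt).
  apply/funext => p; congr prec; congr argmin_perm; apply/funext => j.
  by rewrite /d valK addrAC addrA.
apply: le_trans (unif_expect_translation eps_gt0
  (depends_below_leader (fun s => prec R k s rt) u)
  (coord_measurable_leader (fun s => prec R k s rt) u)
  (prec_bounded_by (leader u) rt) d0) _.
rewrite lerD2l ler_wpM2l ?mulr_ge0 ?(ltW eps_gt0)//.
have -> : m%:R = \sum_(l < m) 1 :> R by rewrite sumr_const card_ord.
by apply: ler_sum => l _; exact: d1.
Qed.

(** Expectation is additive and each block gain involves one draw only, so a single perturbation [p]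
    may serve all blocks. This permits the pointwise use of [be_the_leader]; stability then replaces
    [cum i.+1] by [cum i]. *)
Lemma perturbed_leader_regret (s : 'S_m) :
  \sum_i prec R k s (q i) <=
  \sum_(i < K) unif_expect eps m (fun p => prec R k (leader (cum i) p) (q i)) +
    k%:R * eps^-1 + K%:R * (eps * k%:R * m%:R).
Proof.
have A0 : 0 <= eps^-1 by rewrite invr_ge0 ltW.
pose F (i : 'I_K) p := prec R k (leader (cum i.+1) p) (q i).
have mF i : coord_measurable (F i).
  exact: (coord_measurable_leader (fun s => prec R k s (q i))).
have bF i : bounded_by k%:R (F i) by exact: prec_bounded_by.
have stab (i : 'I_K) : unif_expect eps m (F i) <=
    unif_expect eps m (fun p => prec R k (leader (cum i) p) (q i)) + eps * k%:R * m%:R.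
  rewrite /F; have -> : cum i.+1 = (fun j => cum i j + (q i j)%:R).
    by apply/funext => j; rewrite cumS.
  exact: leader_stability.
have sumF : \sum_i prec R k s (q i) <=
    \sum_i unif_expect eps m (F i) + k%:R * eps^-1.
  rewrite -(unif_expect_sum eps_gt0 _ _ mF bF).
  rewrite -(unif_expect_cst eps_gt0 m (\sum_i prec R k s (q i))).
  rewrite -[k%:R / eps](unif_expect_cst eps_gt0 m).
  have mS := @coord_measurable_sum R _ (index_enum 'I_K) F mF.
  have bS := @bounded_by_sum R _ (index_enum 'I_K) F _ bF.
  have bC : bounded_by (k%:R / eps) (fun=> k%:R / eps).
    by move=> p; rewrite lexx andbT mulr_ge0.
  rewrite -(unif_expectD eps_gt0 _ mS bS _ bC)//.
  apply: (@unif_expect_mono _ _ eps_gt0 _ _ _ (\sum_i prec R k s (q i))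
     (\sum_(i < K) k%:R + k%:R / eps)) => //.
  - by move=> p; rewrite lexx andbT sumr_ge0// => i _; exact: prec_ge0.
  - exact: coord_measurableD.
  - move=> p; have /andP[? ?] := bS p; have /andP[? ?] := bC p.
    by rewrite addr_ge0//= lerD.
  - move=> p pA.
    (* The perturbation is nonnegative, so it only raises the value of the comparator. *)
    apply: (@le_trans _ _ (topk_sum k s (fun j => cum K j + p j))).
      under eq_bigr do rewrite precE.
      rewrite -topk_sum_sum; apply: ler_topk_sum => j.
      by rewrite cum_full lerDl; case/andP: (pA j).
    apply: le_trans (topk_sum_argmin_max _ _ _) _.
    apply: le_trans (be_the_leader A0 pA (leqnn K)) _.
    rewrite addrC lerD2r le_eqVlt; apply/orP; left; apply/eqP.
    by apply: eq_bigl => i; rewrite ltn_ord.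
apply: le_trans sumF _.
rewrite [leRHS]addrAC lerD2r.
have -> : K%:R * (eps * k%:R * m%:R) = \sum_(i < K) (eps * k%:R * m%:R).
  by rewrite sumr_const card_ord mulr_natl.
by rewrite -big_split; apply: ler_sum.
Qed.

End PerturbedLeader.

(** * From block estimates to the rounds of the game *)

Section Blocks.
Variables (R : realType) (m k K L : nat).
Variables (r : nat -> 'I_m -> bool) (expl : nat -> 'I_m -> 'S_m).
Variable eps : R.
Hypothesis eps_gt0 : 0 < eps.
Implicit Types (c : block_choice m K L).

Lemma unif_expect_block a n N F : depends_below n F -> (a + n <= N)%N ->
  unif_expect eps N (fun P => F (fun l => P (a + l)%N)) = unif_expect eps n F.
Proof.
move=> dF aN; rewrite -(subnKC aN) unif_expect_extra ?unif_expect_shift//.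
by move=> P Q PQ; apply: dF => l ln; apply: PQ; rewrite ltn_add2l.
Qed.

(** The block estimate built from the explored rounds; its partial sums [cum] are [shat]. *)
Definition sampled c (i : 'I_K) (j : 'I_m) : bool := r (i * L + c i j)%N j.

Lemma bounded_by_total_gain c :
  bounded_by (\sum_(i < K) \sum_(s < L) k%:R) (total_gain (R := R) k expl r c).
Proof.
by apply: bounded_by_sum => i; apply: bounded_by_sum => s; exact: prec_bounded_by.
Qed.

Lemma coord_measurable_learner c (phi : 'S_m -> R) i s :
  coord_measurable (fun P => phi (learner expl r c P i s)).
Proof.
rewrite /learner; case: pickP => [j _|_]; first exact: coord_measurable_cst.
exact: coord_measurable_argmin.
Qed.

Lemma coord_measurable_total_gain c :
  coord_measurable (total_gain (R := R) k expl r c).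
Proof.
apply: coord_measurable_sum => i; apply: coord_measurable_sum => s.
exact: (coord_measurable_learner _ (fun t => prec R k t (r (i * L + s)%N))).
Qed.

(** Expected gain when the perturbed leader is played, as if no round were used for exploration. *)
Definition exploit_gain c (i : 'I_K) (rt : 'I_m -> bool) : R :=
  unif_expect eps m (fun p => prec R k (leader (cum R (sampled c) i) p) rt).

(** The two learners differ only in exploration rounds, at most [m] in each block, and a round is
    worth at most [k]. *)
Lemma total_gain_exploit c :
  \sum_(i < K) \sum_(s < L) exploit_gain c i (r (i * L + s)%N) <=
  unif_expect eps (K * L * m) (total_gain k expl r c) + (K * m * k)%:R.
Proof.
(* [G] reads the same window of coordinates as [learner], so the two gains coincide outside
   exploration rounds. *)
pose G (i : 'I_K) (s : 'I_L) P := prec R k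
  (leader (cum R (sampled c) i) (fun l => P ((i * L + s) * m + l)%N))
  (r (i * L + s)%N).
have mG i s : coord_measurable (G i s).
  exact: (coord_measurable_argmin (fun t => prec R k t (r (i * L + s)%N))).
have bG i s : bounded_by k%:R (G i s) by exact: prec_bounded_by.
have mGi i : coord_measurable (fun P => \sum_s G i s P) by exact: coord_measurable_sum.
have bGi i : bounded_by (\sum_(s < L) k%:R) (fun P => \sum_s G i s P).
  exact: bounded_by_sum.
have -> : \sum_(i < K) \sum_(s < L) exploit_gain c i (r (i * L + s)%N) =
    unif_expect eps (K * L * m) (fun P => \sum_i \sum_s G i s P).
  rewrite (unif_expect_sum eps_gt0 _ _ mGi bGi); apply: eq_bigr => i _.
  rewrite (unif_expect_sum eps_gt0 _ _ (mG i) (bG i)); apply: eq_bigr => s _.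
  have dF := depends_below_leader (fun t => prec R k t (r (i * L + s)%N))
    (cum R (sampled c) i).
  rewrite /exploit_gain -(@unif_expect_block ((i * L + s) * m) _ (K * L * m) _ dF)//.
  rewrite -mulSnr leq_mul2r; apply/orP; right.
  rewrite (@leq_trans (i.+1 * L))// ?leq_mul2r ?ltn_ord ?orbT//.
  by rewrite mulSnr ltn_add2l.
rewrite -[(K * m * k)%:R](unif_expect_cst eps_gt0 (K * L * m)).
have mT := coord_measurable_total_gain c.
have bT := bounded_by_total_gain c.
have bC : bounded_by (K * m * k)%:R (fun=> (K * m * k)%:R : R).
  by move=> p; rewrite lexx ler0n.
rewrite -(unif_expectD eps_gt0 _ mT bT _ bC)//.
apply: (@unif_expect_mono _ _ eps_gt0 _ _ _ (\sum_(i < K) \sum_(s < L) k%:R)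
  (\sum_(i < K) \sum_(s < L) k%:R + (K * m * k)%:R)).
- exact: coord_measurable_sum.
- exact: bounded_by_sum.
- exact: coord_measurableD.
- move=> P; have /andP[? ?] := bT P.
  by rewrite addr_ge0 ?lerD2r.
move=> P _.
have -> : (K * m * k)%:R = \sum_(i < K) (m * k)%:R :> R.
  by rewrite sumr_const card_ord -[RHS]mulr_natl -natrM mulnA.
rewrite -big_split; apply: ler_sum => i _ /=.
apply: (@le_trans _ _ (\sum_(s < L) (prec R k (learner expl r c P i s) (r (i * L + s)%N)
    + ([exists j, c i j == s] * k)%:R))).
  apply: ler_sum => s _; rewrite /G /learner; case: pickP => [j cj|nc].
    rewrite (_ : [exists j, _]); last by apply/existsP; exists j.
    by rewrite mul1n (le_trans (prec_le _ _ _ _))// lerDr prec_ge0.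
  by rewrite lerDl.
rewrite big_split lerD2l /= -natr_sum ler_nat -big_distrl leq_mul2r.
by rewrite explored_card orbT.
Qed.

(** These probabilities are the weights that make [exploit_gain] linear in the reward vector, so
    that one sampled entry per object suffices. *)
Definition top_prob c (i : 'I_K) (j : 'I_m) : R :=
  unif_expect eps m (fun p => (leader (cum R (sampled c) i) p j < k)%N%:R).

Lemma exploit_gainE c i rt :
  exploit_gain c i rt = \sum_j top_prob c i j * (rt j)%:R.
Proof.
rewrite /exploit_gain /prec (@unif_expect_sum _ _ eps_gt0 _ _ _ _ (fun=> 1)).
- apply: eq_bigr => j _; rewrite /top_prob; case: (rt j).
    by rewrite mulr1; apply: eq_unif_expect => p; rewrite andbT.
  rewrite mulr0 -[RHS](unif_expect_cst eps_gt0 m); apply: eq_unif_expect => p.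
  by rewrite andbF.
- move=> j; exact: (coord_measurable_leader (fun s => ((s j < k)%N && rt j)%:R)).
- by move=> j p; rewrite ler0n lern1 leq_b1.
Qed.

(** The weight [top_prob c i j] depends on [c] only through the blocks before [i], while [c i j] is
    uniform given the other blocks. *)
Lemma exploit_gain_unbiased i :
  \sum_(c : block_choice m K L | valid_choice c)
     \sum_(s < L) exploit_gain c i (r (i * L + s)%N) =
  L%:R * \sum_(c | valid_choice c) exploit_gain c i (sampled c i).
Proof.
transitivity (\sum_j \sum_(c : block_choice m K L | valid_choice c)
   top_prob c i j * \sum_(s < L) (r (i * L + s)%N j)%:R).
  rewrite [RHS]exchange_big; apply: eq_bigr => c _.
  rewrite (eq_bigr _ (fun (s : 'I_L) _ => exploit_gainE c i (r (i * L + s)%N))).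
  by rewrite exchange_big; apply: eq_bigr => j _; rewrite mulr_sumr.
rewrite [in RHS](eq_bigr _ (fun c _ => exploit_gainE c i (sampled c i))).
rewrite [in RHS]exchange_big mulr_sumr; apply: eq_bigr => j _.
rewrite -(@sum_valid_choice_uniform _ _ _ _ (fun c => top_prob c i j) i j
  (fun s => (r (i * L + s)%N j)%:R))// => c c' cc'.
rewrite /top_prob (_ : cum R (sampled c) i = cum R (sampled c') i)//.
apply/funext => j'; apply: eq_bigr => i' i'i; rewrite /sampled cc'//.
by apply: contraTneq i'i => ->; rewrite ltnn.
Qed.

Lemma prec_unbiased (t : 'S_m) (i : 'I_K) :
  \sum_(c : block_choice m K L | valid_choice c)
    \sum_(s < L) prec R k t (r (i * L + s)%N) =
  L%:R * \sum_(c | valid_choice c) prec R k t (sampled c i).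
Proof.
transitivity (\sum_j \sum_(c : block_choice m K L | valid_choice c)
   (t j < k)%N%:R * \sum_(s < L) (r (i * L + s)%N j)%:R : R).
  rewrite [RHS]exchange_big; apply: eq_bigr => c _.
  rewrite (eq_bigr _ (fun (s : 'I_L) _ => precE R k t (r (i * L + s)%N))).
  by rewrite exchange_big; apply: eq_bigr => j _; rewrite mulr_sumr.
rewrite [in RHS](eq_bigr _ (fun c _ => precE R k t (sampled c i))).
rewrite [in RHS]exchange_big mulr_sumr; apply: eq_bigr => j _.
by rewrite -(@sum_valid_choice_uniform _ _ _ _ (fun=> (t j < k)%N%:R) i j
  (fun s => (r (i * L + s)%N j)%:R)).
Qed.

(** Averaged over [c], the comparator and the exploiting learner both gain [L] times what they gain
    on the sampled rewards, where the perturbed leader bound holds for every [c]. *)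
Lemma expected_gain_regret (t : 'S_m) : (m <= L)%N ->
  \sum_(i < K) \sum_(s < L) prec R k t (r (i * L + s)%N) <=
  (#|[pred c : block_choice m K L | valid_choice c]|%:R)^-1 *
    \sum_(c : block_choice m K L | valid_choice c)
      unif_expect eps (K * L * m) (total_gain k expl r c)
  + L%:R * (k%:R * eps^-1 + K%:R * (eps * k%:R * m%:R)) + (K * m * k)%:R.
Proof.
move=> mL; set N := #|_|.
have N0 : 0 < N%:R :> R by rewrite ltr0n valid_choice_exists.
have sumc (x : R) : \sum_(c : block_choice m K L | valid_choice c) x = N%:R * x.
  by rewrite sumr_const mulr_natl.
set reg := k%:R / eps + _.
(* Multiplying by the number of valid choices turns averages into sums over [c]. *)
rewrite -(ler_pM2l N0) [leRHS]mulrDr [X in _ <= X + _]mulrDr mulVKf ?gt_eqF//.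
rewrite -!sumc.
rewrite exchange_big (eq_bigr _ (fun i _ => prec_unbiased t i)) -mulr_sumr exchange_big.
rewrite [leRHS]addrAC -big_split.
apply: (@le_trans _ _ (\sum_(c : block_choice m K L | valid_choice c)
   \sum_(i < K) \sum_(s < L) exploit_gain c i (r (i * L + s)%N) +
   \sum_(c : block_choice m K L | valid_choice c) L%:R * reg)); last first.
  by rewrite lerD2r; apply: ler_sum => c _; exact: total_gain_exploit.
have -> : \sum_(c : block_choice m K L | valid_choice c)
    \sum_(i < K) \sum_(s < L) exploit_gain c i (r (i * L + s)%N) =
    L%:R * \sum_(c | valid_choice c) \sum_i exploit_gain c i (sampled c i).
  by rewrite exchange_big (eq_bigr _ (fun i _ => exploit_gain_unbiased i))
    -mulr_sumr exchange_big.
rewrite -[X in _ <= _ + X]mulr_sumr -mulrDr ler_wpM2l// -big_split.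
apply: ler_sum => c _.
by rewrite /= /reg addrA; exact: perturbed_leader_regret.
Qed.

End Blocks.

(** * Choice of parameters and conclusion *)

Lemma block_length_sq (R : realType) (m T K L : nat) :
  (0 < m)%N -> (0 < K)%N -> T = (K * L)%N ->
  (K%:R : R) = (m%:R : R) `^ (- (1 / 3)) * (T%:R : R) `^ (2 / 3) ->
  (L%:R ^+ 2 = m%:R * K%:R :> R) * 
  ((m%:R : R) `^ (2 / 3) * (T%:R : R) `^ (2 / 3) = L%:R ^+ 2).
Proof.
move=> m0 K0 TE KE.
have mR : (m%:R : R) != 0 by rewrite pnatr_eq0 -lt0n.
have KR : (K%:R : R) != 0 by rewrite pnatr_eq0 -lt0n.
have e1 : (m%:R : R) `^ (2 / 3) * (T%:R : R) `^ (2 / 3) = m%:R * K%:R.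
  rewrite KE mulrA -{2}[m%:R]powRr1 ?ler0n// -powRD ?mR ?implybT//.
  by congr (_ `^ _ * _); lra.
(* The choice of [K] means [m * K ^ 3 = T ^ 2 = K ^ 2 * L ^ 2]; cancel [K ^ 2]. *)
have e2 : L%:R ^+ 2 = m%:R * K%:R :> R.
  have : (m%:R : R) * K%:R ^+ 3 = T%:R ^+ 2.
    rewrite KE exprMn -!powR_mulrn ?powR_ge0 ?ler0n// -!powRrM.
    rewrite mulrA -{1}[m%:R]powRr1 ?ler0n// -powRD ?mR ?implybT//.
    rewrite (_ : 1 + _ = 0) ?powRr0 ?mul1r; last by lra.
    by congr (_ `^ _); lra.
  rewrite TE natrM => h.
  by apply: (@mulfI _ (K%:R ^+ 2)); [rewrite expf_neq0|rewrite -exprMn -h; ring].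
by rewrite e1 e2.
Qed.

Theorem theorem5 (R : realType) :
  exists C : R, 0 < C /\
  forall (m k T K : nat) (r : nat -> 'I_m -> bool)
         (expl : nat -> 'I_m -> 'S_m),
    (0 < m)%N -> (1 <= k)%N ->
    (0 < K)%N -> (K %| T)%N -> (m <= T %/ K)%N ->
    (K%:R : R) = (m%:R : R) `^ (- (1 / 3)) * (T%:R : R) `^ (2 / 3) ->
    (forall t j, nat_of_ord (expl t j j) = 0%N) ->
    let eps : R := Num.sqrt (1 / ((m%:R : R) * K%:R)) in
    @expected_gain R m k T K eps expl r >=
      \big[Num.max/0]_(s : 'S_m) \sum_(t < T) @prec R m k s (r t)
      - C * k%:R * (m%:R : R) `^ (2 / 3) * (T%:R : R) `^ (2 / 3).
Proof.
exists 3; split => // m k T K r expl m0 k1 K0 KT mL KE _.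
cbv zeta; set eps := Num.sqrt _.
pose L := (T %/ K)%N.
have TE : T = (K * L)%N by rewrite mulnC divnK.
have [LL powE] := block_length_sq m0 K0 TE KE.
have L0 : 0 < L%:R :> R by rewrite ltr0n (leq_trans m0).
have epsE : eps = L%:R^-1.
  by rewrite /eps -LL div1r -exprVn sqrtr_sqr gtr0_norm// invr_gt0.
have eps0 : 0 < eps by rewrite epsE invr_gt0.
rewrite lerBlDr -[X in _ + X]mulrA powE.
have key (s : 'S_m) : \sum_(t < T) prec R k s (r t) <=
    expected_gain k T K eps expl r + 3 * k%:R * L%:R ^+ 2.
  have -> : \sum_(t < T) prec R k s (r t) =
      \sum_(i < K) \sum_(u < L) prec R k s (r (i * L + u)%N).
    rewrite -(big_mkord xpredT (fun t => prec R k s (r t))) TE big_nat_mul.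
    rewrite big_mkord; apply: eq_bigr => i _.
    rewrite -{1}[(i * L)%N]add0n big_addn mulSnr addKn big_mkord.
    by apply: eq_bigr => u _; rewrite addnC.
  apply: le_trans (@expected_gain_regret R m k K L r expl eps eps0 s mL) _.
  rewrite /expected_gain -/L TE -addrA lerD2l epsE invrK.
  have -> : (K * m * k)%:R = k%:R * L%:R ^+ 2 :> R by rewrite LL !natrM; ring.
  have -> : K%:R * (L%:R^-1 * k%:R * m%:R) = k%:R * L%:R :> R.
    have -> : K%:R * (L%:R^-1 * k%:R * m%:R) = k%:R * L%:R^-1 * (m%:R * K%:R) :> R by ring.
    by rewrite -LL expr2 mulrA divfK ?gt_eqF.
  by rewrite le_eqVlt; apply/orP; left; apply/eqP; ring.
(* The maximum has default value 0, so the bound must also be nonnegative; this follows from [key]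
   at the identity, as gains are nonnegative. *)
apply: bigmax_le => [|s _]; last exact: key.
by apply: le_trans (key 1%g); apply: sumr_ge0 => t _; exact: prec_ge0.
Qed.
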